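(* Let $m_1,m_2$ be integers with $1 \leq m_1 \leq m_2$, and let $G = K_{1,m_1} + K_{1,m_2}$ be the disjoint union of the stars $K_{1,m_1}$ and $K_{1,m_2}$. Then $G$ is equitably 2-choosable if and only if $m_2 - m_1 \leq 1$ and $m_1 + m_2 \leq 15$.
   Context: All graphs are finite and simple. A list assignment $L$ for a graph $G$ assigns to each vertex $v$ a set $L(v)$ of colors; it is a $k$-assignment if $|L(v)|=k$ for all $v$. The palette of $L$ is $\bigcup_{v \in V(G)} L(v)$. A proper $L$-coloring is a proper coloring $f$ with $f(v)\in L(v)$ for all $v$. If $L$ is a $k$-assignment, an equitable $L$-coloring of $G$ is a proper $L$-coloring in which each color of the palette appears on at most $\lceil |V(G)|/k \rceil$ vertices. $G$ is equitably $k$-choosable if an equitable $L$-coloring exists for every $k$-assignment $L$ for $G$. $G_1+G_2$ denotes the disjoint union of vertex-disjoint graphs $G_1$ and $G_2$. *)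

(* Defs.v *)
From HB Require Import structures.
From mathcomp Require Import all_boot.

Set Implicit Arguments.
Unset Strict Implicit.
Unset Printing Implicit Defensive.

Record sgraph := SGraph {
  svertex :> finType;
  sedge : rel svertex;
  sedge_sym : symmetric sedge;
  sedge_irr : irreflexive sedge
}.

Section CompleteBipartite.
Variables a b : nat.

Definition Kab_rel : rel ('I_a + 'I_b)%type := fun x y =>
  match x, y with
  | inl _, inr _ | inr _, inl _ => true
  | _, _ => false
  end.

Lemma Kab_sym : symmetric Kab_rel.
Proof. by case=> [?|?] [?|?]. Qed.

Lemma Kab_irr : irreflexive Kab_rel.
Proof. by case. Qed.

Definition complete_bipartite : sgraph := SGraph Kab_sym Kab_irr.

End CompleteBipartite.

Definition star (m : nat) : sgraph := complete_bipartite 1 m.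

Section DisjointUnion.
Variables G1 G2 : sgraph.

Definition disjoint_union_rel : rel (G1 + G2)%type := fun x y =>
  match x, y with
  | inl u, inl v => sedge u v
  | inr u, inr v => sedge u v
  | _, _ => false
  end.

Lemma disjoint_union_sym : symmetric disjoint_union_rel.
Proof. by case=> u [] v //=; apply: sedge_sym. Qed.

Lemma disjoint_union_irr : irreflexive disjoint_union_rel.
Proof. by case=> u /=; apply: sedge_irr. Qed.

Definition disjoint_union : sgraph :=
  SGraph disjoint_union_sym disjoint_union_irr.

End DisjointUnion.

(* n / k rounded up, for k > 0 *)
Definition ceil_div (n k : nat) : nat := (n + k.-1) %/ k.

Section ListColoring.
Variables (G : sgraph) (C : finType).

Definition list_assignment := G -> {set C}.

Definition k_assignment (k : nat) (L : list_assignment) : Prop :=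
  forall v, #|L v| = k.

Definition palette (L : list_assignment) : {set C} := \bigcup_(v : G) L v.

Definition proper_coloring (f : G -> C) : Prop :=
  forall u v : G, sedge u v -> f u <> f v.

Definition proper_list_coloring (L : list_assignment) (f : G -> C) : Prop :=
  proper_coloring f /\ forall v, f v \in L v.

Definition equitable_list_coloring
    (k : nat) (L : list_assignment) (f : G -> C) : Prop :=
  proper_list_coloring L f /\
  forall c, c \in palette L -> #|[set v | f v == c]| <= ceil_div #|G| k.

End ListColoring.

(* The palette of a k-assignment of a finite graph is finite, so letting C
   range over all finite types of colors covers every k-assignment. *)
Definition equitably_choosable (k : nat) (G : sgraph) : Prop :=
  forall (C : finType) (L : list_assignment G C), k_assignment k L ->
    exists f : G -> C, equitable_list_coloring k L f.

(* Main.v *)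
Require Import Defs.
From mathcomp Require Import all_boot.
From mathcomp Require Import zify.

(** Give the centers colors a and b; every leaf then loses at most one color
  from its list. The capacity K satisfies |V| <= 2K, so two colors cannot both
  be overfull, and moving a leaf with a remaining choice out of an overfull
  class shows that an equitable coloring exists as soon as no color is forced
  on more than K vertices. When m1 <= m2 <= m1 + 1 we have K = m2 + 1, and
  (a, b) is obstructed exactly by a color c outside {a, b} such that {a, c}
  (in the first star) and {b, c} (in the second one) are together the lists of
  at least m2 + 2 leaves. If the four pairs (a, b) are all obstructed, then
  comparing the obstructing colors of pairs that share a center color shows
  that either a single color obstructs all of them, which takes too many
  leaves, or one of the stars uses the list of its center in all four
  obstructions while the other one uses four distinct lists. The latter
  requires at least 8 leaves in the first star, and 8 leaves suffice. *)

Set Implicit Arguments.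
Unset Strict Implicit.
Unset Printing Implicit Defensive.

(** * Balancing overfull color classes *)

Section Exchange.
Variables (I C : finType) (R : I -> {set C}) (K : nat).

Let load (f : I -> C) c := #|[set i | f i == c]|.

Lemma load_le_of_forced_le :
  (forall i, R i != set0) -> #|I| <= K.*2 ->
  (forall c, #|[set i | R i \subset [set c]]| <= K) ->
  exists f : I -> C, (forall i, f i \in R i) /\
    forall c, #|[set i | f i == c]| <= K.
Proof.
move=> R_n0 leIK forcedK.
have [f0 f0R] : exists f : I -> C, forall i, f i \in R i.
  exists (fun i => xchoose (set0Pn _ (R_n0 i))) => i; exact: xchooseP.
(* Induction on the total excess over the capacity; truncated subtraction makes underfull classes
   count as 0. *)
have [n] := ubnP (\sum_c (load f0 c - K)).
elim: n f0 f0R => // n IHn f fR le_n.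
have [/forallP ok | /forallPn [c]] := boolP [forall c, load f c <= K].
  by exists f.
rewrite -ltnNge => cK.
have /subsetPn [i] :
    ~~ ([set i | f i == c] \subset [set i | R i \subset [set c]]).
  apply/negP => /subset_leq_card le_c.
  by have := leq_trans cK (leq_trans le_c (forcedK c)); rewrite ltnn.
rewrite !inE => /eqP fic /subsetPn [d dR]; rewrite inE => dc.
(* Since [c] exceeds [K] and the two classes share at most [K.*2] indices, [d] has room for one
   more: the move creates no new excess. *)
have le_cd : load f c + load f d <= #|I|.
  rewrite /load -cardsUI (_ : _ :&: _ = set0) ?cards0 ?addn0 ?max_card //.
  apply/setP=> j; rewrite !inE; apply/negP=> /andP[/eqP-> /eqP cd].
  by rewrite cd eqxx in dc.
pose g j := if j == i then d else f j.
have gc : load f c = (load g c).+1.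
  rewrite /load (cardsD1 i) inE fic eqxx add1n; congr _.+1.
  apply: eq_card => j; rewrite !inE /g.
  by case: (j == i) => //=; rewrite (negbTE dc).
have gd : load g d = (load f d).+1.
  rewrite /load (cardsD1 i) inE /g !eqxx add1n; congr _.+1.
  apply: eq_card => j; rewrite !inE; case: eqP => //= ->.
  by rewrite fic eq_sym (negbTE dc).
have ge e : e != c -> e != d -> load g e = load f e.
  move=> ec ed; apply: eq_card => j; rewrite !inE /g.
  case: (eqVneq j i) => [->|//].
  by rewrite fic ![_ == e]eq_sym (negbTE ec) (negbTE ed).
apply: (IHn g) => [j|]; first by rewrite /g; case: (eqVneq j i) => [->|_].
apply: leq_trans (ltnSE le_n).
rewrite (bigD1 c) // [X in _ < X](bigD1 c) //=.
rewrite (bigD1 d) //= [X in _ < _ + X](bigD1 d) //=.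
under eq_bigr => e /andP[ec ed] do rewrite ge //.
lia.
Qed.

End Exchange.

(** * Counting leaves by their lists *)

Section ListMultiplicity.
Variables (I : finType) (C : finType) (M : I -> {set C}).

Definition mult (X : {set C}) := #|[set i | M i == X]|.

(** Double counting: each index has only one list, so it contributes to at most one term. *)
Lemma sum_mult_le (s : seq {set C}) :
  uniq s -> \sum_(X <- s) mult X <= #|I|.
Proof.
move=> Us; rewrite /mult.
under eq_bigr => X _ do rewrite -sum1dep_card big_mkcond /=.
rewrite exchange_big /= -sum1_card; apply: leq_sum => i _.
rewrite -big_mkcond /= sum1_count.
rewrite (@eq_count _ _ (pred1 (M i))) => [|X]; last by rewrite /= eq_sym.
by rewrite count_uniq_mem //; case: (_ \in _).
Qed.

Lemma mult2_le X Y : X != Y -> mult X + mult Y <= #|I|.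
Proof.
move=> XY; have := @sum_mult_le [:: X; Y].
by rewrite /= inE XY !big_cons big_nil addn0; apply.
Qed.

Lemma mult_le X : mult X <= #|I|.
Proof. exact: max_card. Qed.

Lemma card_forced a c : (forall i, #|M i| = 2) ->
  #|[set i | M i :\ a \subset [set c]]|
    = if c == a then 0 else mult [set a; c].
Proof.
move=> M2; have D1 i : M i :\ a \subset [set c] = (M i \subset [set a; c]).
  by rewrite subDset.
case: (eqVneq c a) => [ca | ca].
  apply: eq_card0 => i; rewrite !inE D1 ca setUid.
  apply/negP => /subset_leq_card.
  by rewrite M2 cards1.
apply: eq_card => i; rewrite !inE D1 eqEcard cards2 M2 eq_sym ca.
by rewrite andbT.
Qed.

End ListMultiplicity.

Lemma set2_neq (C : finType) (b c b' c' : C) :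
  b != b' -> ~ (c = b' /\ c' = b) -> [set b; c] != [set b'; c'].
Proof.
move=> bb' H; apply/eqP => E; apply: H.
have := set21 b c; have := set21 b' c'.
rewrite E -{1}E !inE (negbTE bb') eq_sym (negbTE bb') /=.
by move=> /eqP-> /eqP<-.
Qed.

(** * Obstructed pairs of center colors *)

Section Obstructions.
Variables (C I J : finType) (M : I -> {set C}) (N : J -> {set C}).

Definition obstructed x y z :=
  [/\ z != x, z != y & #|J|.+2 <= mult M [set x; z] + mult N [set y; z]].

(** Otherwise the two obstructions use distinct lists in each star, so together they count at most
    [#|I| + #|J|] leaves, fewer than the required [2 * #|J|.+2]. *)
Lemma obstructed_row x b b' c c' : b != b' -> #|I| <= #|J| ->
  obstructed x b c -> obstructed x b' c' -> c = c' \/ c = b' /\ c' = b.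
Proof.
move=> bb' leIJ [cx cb H] [c'x c'b' H'].
case: (eqVneq c c') => [|cc']; first by left.
right; have [/andP[/eqP-> /eqP->] // | nE] := boolP ((c == b') && (c' == b)).
have E : [set x; c] != [set x; c'].
  rewrite ![[set x; _]]setUC; apply: set2_neq => // -[xc' _].
  by rewrite xc' eqxx in c'x.
have E' : [set b; c] != [set b'; c'].
  by apply: set2_neq => // -[e e']; rewrite e e' !eqxx in nE.
by have := mult2_le M E; have := mult2_le N E'; lia.
Qed.

Lemma obstructed_col a a' y c c' : a != a' -> #|I| <= #|J| ->
  obstructed a y c -> obstructed a' y c' -> c = c' \/ c = a' /\ c' = a.
Proof.
move=> aa' leIJ [ca cy H] [c'a' c'y H'].
case: (eqVneq c c') => [|cc']; first by left.
right; have [/andP[/eqP-> /eqP->] // | nE] := boolP ((c == a') && (c' == a)).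
have E : [set y; c] != [set y; c'].
  rewrite ![[set y; _]]setUC; apply: set2_neq => // -[yc' _].
  by rewrite yc' eqxx in c'y.
have E' : [set a; c] != [set a'; c'].
  by apply: set2_neq => // -[e e']; rewrite e e' !eqxx in nE.
by have := mult2_le N E; have := mult2_le M E'; lia.
Qed.

End Obstructions.

(** The four lists are the edges of a 4-cycle on four distinct colors, hence distinct. *)
Lemma sum_mult_grid_le (C I : finType) (M : I -> {set C}) (x x' y y' : C) :
  x != x' -> y != y' -> y != x -> y != x' -> y' != x -> y' != x' ->
  mult M [set x; y] + mult M [set x; y'] + mult M [set x'; y]
    + mult M [set x'; y'] <= #|I|.
Proof.
move=> xx' yy' yx yx' y'x y'x'.
have := @sum_mult_le _ _ M
  [:: [set x; y]; [set x; y']; [set x'; y]; [set x'; y']].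
rewrite !big_cons big_nil addn0 !addnA; apply.
have E z : z \in [:: x; x'] -> [set z; y] != [set z; y'].
  rewrite ![[set z; _]]setUC => zx; apply: set2_neq => // -[zy' _].
  by move: zx; rewrite zy' !inE (negbTE y'x) (negbTE y'x').
have F u v : v \in [:: y; y'] -> [set x; u] != [set x'; v].
  move=> vy; apply: set2_neq => // -[_ vx].
  by move: vy; rewrite vx !inE ![x == _]eq_sym (negbTE yx) (negbTE y'x).
by rewrite /= !inE !negb_or !E ?F ?inE ?eqxx ?orbT.
Qed.

Lemma exists_unobstructed (C I J : finType) (M : I -> {set C})
    (N : J -> {set C}) (a a' b b' : C) :
  a != a' -> b != b' -> #|I| <= #|J| -> #|I| <= 7 ->
  exists x y, [/\ x \in [set a; a'], y \in [set b; b']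
    & forall z, ~ obstructed M N x y z].
Proof.
move=> aa' bb' leIJ leI7.
have obs x y : (exists z, obstructed M N x y z) \/
               (forall z, ~ obstructed M N x y z).
  pose P z := [&& z != x, z != y &
    #|J|.+2 <= mult M [set x; z] + mult N [set y; z]].
  have [/existsP[z /and3P[*]] | /existsPn nP] := boolP [exists z, P z].
    by left; exists z.
  by right=> z [zx zy H]; move: (nP z); rewrite /P zx zy H.
have [[c1 o1]|] := obs a b; last by exists a, b; rewrite !set21.
have [[c2 o2]|] := obs a b'; last by exists a, b'; rewrite set21 set22.
have [[c3 o3]|] := obs a' b; last by exists a', b; rewrite set21 set22.
have [[c4 o4]|] := obs a' b'; last by exists a', b'; rewrite !set22.
exfalso.
have r1 := obstructed_row bb' leIJ o1 o2.
have r2 := obstructed_row bb' leIJ o3 o4.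
have k1 := obstructed_col aa' leIJ o1 o3.
have k2 := obstructed_col aa' leIJ o2 o4.
case: o1 o2 o3 o4 => [/eqP n1 /eqP n1' H1] [/eqP n2 /eqP n2' H2].
move=> [/eqP n3 /eqP n3' H3] [/eqP n4 /eqP n4' H4].
have [[e1 e2 e3 e4]|[[e1 e2 e3 e4]|[e1 e2 e3 e4]]] :
    [/\ c1 = c4, c2 = c4, c3 = c4 & c4 = c4] \/
    [/\ c1 = a', c2 = a', c3 = a & c4 = a] \/
    [/\ c1 = b', c2 = b, c3 = b' & c4 = b].
  move/eqP: aa' => aa'; move/eqP: bb' => bb'.
  case: r1 r2 k1 k2 => [?|[? ?]] [?|[? ?]] [?|[? ?]] [?|[? ?]];
  first [ by left; split; congruence | by right; left; split; congruence
        | by right; right; split; congruence | by exfalso; congruence ].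
- subst c1 c2 c3.
  have /(mult2_le M) : [set a; c4] != [set a'; c4].
    by apply: set2_neq => // -[].
  have /(mult2_le N) : [set b; c4] != [set b'; c4].
    by apply: set2_neq => // -[].
  by lia.
(* Adding the four obstructions gives [4 * #|J|.+2 <= 4 * #|I| + #|J|], which forces [8 <= #|I|]. *)
- subst c1 c2 c3 c4.
  rewrite [[set a'; a]]setUC in H3 H4.
  have := mult_le M [set a; a'].
  have := @sum_mult_grid_le _ _ N b b' a a' bb' aa'.
  by move=> /(_ (introN eqP n3') (introN eqP n4') (introN eqP n1')
    (introN eqP n2')); lia.
(* With the stars exchanged, the sum is [4 * #|J|.+2 <= #|I| + 4 * #|J|], and again [8 <= #|I|]. *)
- subst c1 c2 c3 c4.
  rewrite [[set b'; b]]setUC in H2 H4.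
  have := mult_le N [set b; b'].
  have := @sum_mult_grid_le _ _ M a a' b b' aa' bb'.
  by move=> /(_ (introN eqP n2) (introN eqP n4) (introN eqP n1)
    (introN eqP n3)); lia.
Qed.

(** * The union of two stars: sufficiency, then necessity *)

Section DoubleStar.
Variables m1 m2 : nat.
Local Notation G := (disjoint_union (star m1) (star m2)).

Definition center1 : G := inl (inl ord0).
Definition center2 : G := inr (inl ord0).
Definition leaf1 (i : 'I_m1) : G := inl (inr i).
Definition leaf2 (j : 'I_m2) : G := inr (inr j).

Lemma card_double_star_set (P : pred G) :
  #|[set v | P v]| = P center1 + #|[set i | P (leaf1 i)]|
                     + (P center2 + #|[set j | P (leaf2 j)]|).
Proof.
have sum_I1 (Q : pred 'I_1) : \sum_(i | Q i) 1 = Q ord0.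
  by rewrite big_mkcond big_ord1; case: (Q _).
by rewrite -!sum1dep_card big_sumType /= !big_sumType /= !sum_I1.
Qed.

Lemma card_double_star : #|G| = (m1 + m2).+2.
Proof. by rewrite !card_sum !card_ord; lia. Qed.

Lemma proper_double_star (C : finType) (f : G -> C) :
  proper_coloring f <->
  (forall i, f (leaf1 i) <> f center1) /\ (forall j, f (leaf2 j) <> f center2).
Proof.
split=> [fP|[f1 f2]]; first by split=> ?; apply: fP.
move=> [[u|u]|[u|u]] [[v|v]|[v|v]] //= _; rewrite ?ord1.
- exact/nesym/f1.
- exact: f1.
- exact/nesym/f2.
- exact: f2.
Qed.

Lemma double_star_equitably_choosable :
  1 <= m1 -> m1 <= m2 -> m2 - m1 <= 1 -> m1 + m2 <= 15 ->
  equitably_choosable 2 G.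
Proof.
move=> hm1 hm12 hd hs C L L2.
have K_def : ceil_div #|G| 2 = m2.+1.
  by rewrite /ceil_div card_double_star; lia.
have /eqP/cards2P [a [a' [aa' La]]] := L2 center1.
have /eqP/cards2P [b [b' [bb' Lb]]] := L2 center2.
have [||x [y [xL yL unobs]]] :=
    @exists_unobstructed C _ _ (L \o leaf1) (L \o leaf2) a a' b b' aa' bb'.
- by rewrite !card_ord.
- by rewrite card_ord; lia.
rewrite -La in xL; rewrite -Lb in yL.
(* With the centers pinned to [x] and [y], every choice from [R] is a proper coloring. *)
pose R (v : G) : {set C} := match v with
  | inl (inl _) => [set x]
  | inr (inl _) => [set y]
  | inl (inr _) => L v :\ x
  | inr (inr _) => L v :\ y
  end.
have D1_n0 v z : L v :\ z != set0.
  rewrite -card_gt0; have := cardsD1 z (L v).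
  by rewrite L2; case: (_ \in _) => /=; lia.
have [|||f [fR fK]] := @load_le_of_forced_le G C R m2.+1.
- case=> [[u|u]|[u|u]] /=; rewrite ?D1_n0 //; apply/set0Pn.
    by exists x; rewrite inE.
  by exists y; rewrite inE.
- by rewrite card_double_star; lia.
- move=> c; rewrite card_double_star_set /= !sub1set !inE.
  rewrite (@card_forced _ _ (L \o leaf1)); last by move=> i; apply: L2.
  rewrite (@card_forced _ _ (L \o leaf2)); last by move=> i; apply: L2.
  have := mult_le (L \o leaf1) [set x; c]; rewrite card_ord.
  have := mult_le (L \o leaf2) [set y; c]; rewrite card_ord.
  rewrite ![_ == c]eq_sym.
  (* If [c] is a center color, no leaf of that star is forced to it, so the count stays within
     [m2.+1]. Otherwise an excess would be an obstruction. *)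
  case: (eqVneq c x) => cx; case: (eqVneq c y) => cy /=; try lia.
  rewrite !add0n => _ _; rewrite leqNgt; apply/negP => H.
  by apply: (unobs c); split=> //; rewrite card_ord.
have fx : f center1 = x by apply/set1P/(fR center1).
have fy : f center2 = y by apply/set1P/(fR center2).
exists f; split; last by move=> c _; rewrite K_def; apply: fK.
split.
  apply/proper_double_star; rewrite fx fy.
  split=> i; apply/eqP.
    by have := fR (leaf1 i); rewrite !inE => /andP[].
  by have := fR (leaf2 i); rewrite !inE => /andP[].
move=> [[u|u]|[u|u]].
- by rewrite ord1 [f _]fx.
- by have := fR (leaf1 u); rewrite !inE => /andP[].
- by rewrite ord1 [f _]fy.
- by have := fR (leaf2 u); rewrite !inE => /andP[].
Qed.

(** With all lists equal to [bool], the color missing at the second center fills all [m2] leaves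
    there and appears at least once in the first star. *)
Lemma equitably_choosable_balanced :
  1 <= m1 -> m1 <= m2 -> equitably_choosable 2 G -> m2 - m1 <= 1.
Proof.
move=> hm1 hm12 /(_ bool (fun=> setT)) [|f [[/proper_double_star[f1 f2] _] fK]].
  by move=> v; rewrite cardsT card_bool.
have := fK (~~ f center2).
have -> : ~~ f center2 \in palette (fun _ : G => [set: bool]).
  by apply/bigcupP; exists center1; rewrite ?inE.
move=> /(_ isT); rewrite /ceil_div card_double_star card_double_star_set.
have -> : [set j | f (leaf2 j) == ~~ f center2] = setT.
  by apply/setP=> j; rewrite !inE; move: (f2 j); do 2!case: (f _).
have : 1 <= (f center1 == ~~ f center2)
            + #|[set i | f (leaf1 i) == ~~ f center2]|.
  have [//|ne] := eqVneq (f center1) (~~ f center2).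
  rewrite card_gt0; apply/set0Pn; exists (Ordinal hm1); rewrite inE.
  by move: ne (f1 (Ordinal hm1)); do 3!case: (f _).
by rewrite cardsT card_ord; lia.
Qed.

(* The center colors (true, s) and (false, t) force (false, ~~ t) on the whole
  second star and on the leaves of the first one with list
  {(true, s), (false, ~~ t)}; each such list occurs twice as soon as m1 >= 8. *)
Definition bad_lists (v : G) : {set bool * bool} :=
  match v with
  | inl (inl _) => [set (true, true); (true, false)]
  | inl (inr i) => [set (true, odd i); (false, odd i./2)]
  | inr _ => [set (false, true); (false, false)]
  end.

Lemma equitably_choosable_small :
  m1 <= m2 -> m2 - m1 <= 1 -> equitably_choosable 2 G -> m1 + m2 <= 15.
Proof.
move=> hm12 hd /(_ _ bad_lists) [|f [[/proper_double_star[f1 f2] fL] fK]].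
  by case=> [[u|u]|u]; rewrite cards2.
rewrite leqNgt; apply/negP => hs.
have [s fs] : exists s : bool, f center1 = (true, s).
  by have := fL center1; rewrite !inE => /orP[] /eqP ->; eexists.
have [t ft] : exists t : bool, f center2 = (false, t).
  by have := fL center2; rewrite !inE => /orP[] /eqP ->; eexists.
have := fK (false, ~~ t).
have -> : (false, ~~ t) \in palette bad_lists.
  by apply/bigcupP; exists center2; rewrite ?inE //; case: (t).
move=> /(_ isT); rewrite /ceil_div card_double_star card_double_star_set.
have -> : [set j | f (leaf2 j) == (false, ~~ t)] = setT.
  apply/setP=> j; rewrite !inE; move: (f2 j) (fL (leaf2 j)).
  by rewrite ft !inE => + /orP[] /eqP fj; rewrite fj; case: (t).
(* The two lowest bits of the index, [s] and [~~ t], select the forced list; [k] gives two such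
   leaves, both below 8. *)
have i0P k : k < 2 -> 4 * k + 2 * ~~ t + s < m1.
  by case: (t); case: (s) => /=; lia.
pose i0 := Ordinal (i0P 0 isT); pose i1 := Ordinal (i0P 1 isT).
have forced (i : 'I_m1) :
    odd i = s -> odd i./2 = ~~ t -> f (leaf1 i) = (false, ~~ t).
  move=> odd_i odd_i2; move: (f1 i) (fL (leaf1 i)).
  by rewrite fs !inE odd_i odd_i2 => + /orP[] /eqP.
have : 2 <= #|[set i | f (leaf1 i) == (false, ~~ t)]|.
  have <- : #|[set i0; i1]| = 2 by rewrite cards2 -val_eqE /=; lia.
  apply/subset_leq_card/subsetP => i; rewrite !inE => /orP[] /eqP ->;
    apply/eqP/forced => /=; by case: (t); case: (s).
by rewrite cardsT card_ord; lia.
Qed.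

End DoubleStar.

Theorem theorem1p4 (m1 m2 : nat) (hm1 : 1 <= m1) (hm12 : m1 <= m2) :
  equitably_choosable 2 (disjoint_union (star m1) (star m2)) <->
  (m2 - m1 <= 1 /\ m1 + m2 <= 15).
Proof.
split=> [choosable | [hd hs]]; last exact: double_star_equitably_choosable.
have hd := equitably_choosable_balanced hm1 hm12 choosable.
by split=> //; apply: equitably_choosable_small.
Qed.
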